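(* Let $n\ge 2$, and let $W=(w_{ij})$ be an $n\times n$ matrix with zero diagonal and off-diagonal entries in $(0,1)$ such that the associated system of ML equations (given in the context) has a unique solution $\hat\theta=(\hat a,\hat b)\in(0,\infty)^{2n}$. Let $f=(g,h)$ be the fixed-point map defined in the context. Then there is a closed neighborhood $K$ of $\hat\theta$ on which $f$ is a contraction, and consequently, for every starting point $\theta^{(0)}\in K$, the sequence $\theta^{(it)}=f(\theta^{(it-1)})$, $it=1,2,\dots$, converges, and its limit, the fixed point of the iteration, is $\hat\theta$.
   Context: $\psi(x)=\Gamma'(x)/\Gamma(x)$, $x>0$, is the digamma function; it is a strictly increasing bijection $(0,\infty)\to\mathbb{R}$, with inverse $\psi^{-1}:\mathbb{R}\to(0,\infty)$. For $W$ as in the claim put $R_i=\sum_{j\ne i}\ln w_{ij}$ and $C_j=\sum_{i\ne j}\ln(1-w_{ij})$. The ML equations, in the unknown $\theta=(a,b)=(a_1,\dots,a_n,b_1,\dots,b_n)\in(0,\infty)^{2n}$, are $$\sum_{j\ne i}\psi(a_i+b_j)-(n-1)\psi(a_i)+R_i=0\quad(i=1,\dots,n),\qquad \sum_{i\ne j}\psi(a_i+b_j)-(n-1)\psi(b_j)+C_j=0\quad(j=1,\dots,n).$$ The map $f=(g_1,\dots,g_n,h_1,\dots,h_n):(0,\infty)^{2n}\to(0,\infty)^{2n}$ is defined by $$g_i(a,b)=\psi^{-1}\Big[\tfrac1{n-1}R_i+\tfrac1{n-1}\sum_{j\ne i}\psi(a_i+b_j)\Big],\qquad h_j(a,b)=\psi^{-1}\Big[\tfrac1{n-1}C_j+\tfrac1{n-1}\sum_{i\ne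 j}\psi(a_i+b_j)\Big].$$ The ML equations are equivalent to $\theta=f(\theta)$. ''$f$ is a contraction on $K$'' means that $K\subset(0,\infty)^{2n}$, $f(K)\subseteq K$, and for some norm on $\mathbb{R}^{2n}$ and some $q<1$ one has $\|f(x)-f(y)\|\le q\|x-y\|$ for all $x,y\in K$. *)

(* Defs.v *)
From mathcomp Require Export all_boot all_order all_algebra.
From mathcomp Require Export all_classical all_reals all_analysis.
Export Order.TTheory GRing.Theory Num.Theory.
Export numFieldNormedType.Exports.

Set Implicit Arguments.
Unset Strict Implicit.
Unset Printing Implicit Defensive.

Local Open Scope classical_set_scope.
Local Open Scope ring_scope.

(* Euler's integral; convergent, hence meaningful, for 0 < x. *)
Definition Gamma (R : realType) (x : R) : R :=
  \int[@lebesgue_measure R]_(t in `]0, +oo[) (t `^ (x - 1) * expR (- t)).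

Definition digamma (R : realType) (x : R) : R := derive1 (@Gamma R) x / Gamma x.

(* digamma is a bijection from ]0, +oo[ onto R, so this partial inverse is a
   true inverse and the default value 1 is never used. *)
Definition digamma_inv (R : realType) : R -> R :=
  'pinv_(fun=> 1) `]0, +oo[ (@digamma R).

(* A parameter theta = (a, b) is the row vector row_mx a b. *)
Definition par_a (R : realType) (n : nat) (theta : 'rV[R]_(n + n)) (i : 'I_n) : R :=
  lsubmx theta 0 i.

Definition par_b (R : realType) (n : nat) (theta : 'rV[R]_(n + n)) (j : 'I_n) : R :=
  rsubmx theta 0 j.

Definition positive_orthant (R : realType) (m : nat) : set 'rV[R]_m :=
  [set x | forall k, 0 < x 0 k].

Definition rowstat (R : realType) (n : nat) (W : 'M[R]_n) (i : 'I_n) : R :=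
  \sum_(j < n | j != i) ln (W i j).

Definition colstat (R : realType) (n : nat) (W : 'M[R]_n) (j : 'I_n) : R :=
  \sum_(i < n | i != j) ln (1 - W i j).

Definition ML_equations (R : realType) (n : nat) (W : 'M[R]_n)
    (theta : 'rV[R]_(n + n)) : Prop :=
  (forall i : 'I_n,
     \sum_(j < n | j != i) digamma (par_a theta i + par_b theta j)
       - (n%:R - 1) * digamma (par_a theta i) + rowstat W i = 0) /\
  (forall j : 'I_n,
     \sum_(i < n | i != j) digamma (par_a theta i + par_b theta j)
       - (n%:R - 1) * digamma (par_b theta j) + colstat W j = 0).

Definition ML_solution (R : realType) (n : nat) (W : 'M[R]_n)
    (theta : 'rV[R]_(n + n)) : Prop :=
  positive_orthant theta /\ ML_equations W theta.

Definition fpmap_g (R : realType) (n : nat) (W : 'M[R]_n)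
    (theta : 'rV[R]_(n + n)) (i : 'I_n) : R :=
  digamma_inv ((n%:R - 1)^-1 * rowstat W i + (n%:R - 1)^-1 *
    \sum_(j < n | j != i) digamma (par_a theta i + par_b theta j)).

Definition fpmap_h (R : realType) (n : nat) (W : 'M[R]_n)
    (theta : 'rV[R]_(n + n)) (j : 'I_n) : R :=
  digamma_inv ((n%:R - 1)^-1 * colstat W j + (n%:R - 1)^-1 *
    \sum_(i < n | i != j) digamma (par_a theta i + par_b theta j)).

Definition fpmap (R : realType) (n : nat) (W : 'M[R]_n)
    (theta : 'rV[R]_(n + n)) : 'rV[R]_(n + n) :=
  row_mx (\row_i fpmap_g W theta i) (\row_j fpmap_h W theta j).

(* Nonnegativity and N 0 = 0 follow from the three clauses. *)
Definition is_norm (R : realType) (m : nat) (N : 'rV[R]_m -> R) : Prop :=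
  [/\ forall x, N x = 0 -> x = 0,
      forall (c : R) x, N (c *: x) = `|c| * N x
    & forall x y, N (x + y) <= N x + N y].

Definition is_contraction_on (R : realType) (m : nat) (f : 'rV[R]_m -> 'rV[R]_m)
    (K : set 'rV[R]_m) : Prop :=
  [/\ K `<=` @positive_orthant R m,
      f @` K `<=` K
    & exists (N : 'rV[R]_m -> R) (q : R),
        [/\ is_norm N, q < 1
          & forall x y, K x -> K y -> N (f x - f y) <= q * N (x - y)]].

(* Main.v *)
Require Import Defs.
From mathcomp Require Import measurable_realfun exponential_distribution ftc.
From mathcomp Require Import ring lra.

(** Write th = (a, b) for the solution and psi for the digamma function.  The
    map f has nonnegative partial derivatives at th: in row i they are
    psi'(a_i + b_j) / ((n - 1) psi'(a_i)) in the variable b_j, and the sum of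
    these over j in the variable a_i.  Hence f contracts near th, in a weighted
    maximum norm, as soon as some positive vector is strictly decreased by this
    Jacobian matrix.  The vector th itself is: applied to it, row i reads
      1/(n-1) sum_(j != i) (a_i + b_j) psi'(a_i + b_j) / psi'(a_i) < a_i,
    because x psi'(x) is strictly decreasing on (0, +oo).  So the norm is
    max_k |x_k| / th_k, and K is a ball of this norm around th.

    No derivative of psi or of f is taken.  The function psi' is replaced by
    the series [trigamma], D(x) = sum_k 1/(x+k)^2, and differentiability by an
    estimate on whole intervals: between two points of [c(1-e), c(1+e)] the
    slope of psi lies between D(c)/(1+e)^2 and D(c)/(1-e)^2 ([digamma_slope]).
    For small e these bounds are so close that the strict inequality
    s D(s) < c D(c) for c < s ([trigamma_mul_lt]) survives in
    [digamma_inv_mean_lipschitz], the contraction estimate for one coordinate.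
    The bounds also keep the argument of the inverse of psi in the image of a
    small interval around c, so only a local inverse of psi is ever needed.

    The estimate on psi rests on Euler's integral through three facts:
    Gamma(1) = 1, Gamma(x+1) = x Gamma(x), and Wendel's inequality
    Gamma(x+s) <= x^s Gamma(x) for 0 <= s <= 1, which is Bernoulli's inequality
    integrated.  The last two squeeze the slopes of ln Gamma far to the right,
    and the functional equation carries them back to x: ln Gamma is
    differentiable, with psi(x) = lim_N (ln(x+N) - sum_(k<N) 1/(x+k)), whence
    psi(v) - psi(u) = (v-u) sum_k 1/((u+k)(v+k)). *)
Local Open Scope classical_set_scope.
Local Open Scope ring_scope.

(** * Euler's integral *)

Section EulerIntegral.
Set Implicit Arguments.
Unset Strict Implicit.
Unset Printing Implicit Defensive.
Context {R : realType}.
Notation mu := (@lebesgue_measure R).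
Implicit Types x s t u : R.

Definition gamma_integrand x t : R := t `^ (x - 1) * expR (- t).

(** Kept in the extended reals, so that the functional equation and Wendel's
    inequality can be proved before finiteness, which follows from them. *)
Definition euler_integral x : \bar R :=
  (\int[mu]_(t in `]0%R, +oo[) (gamma_integrand x t)%:E)%E.

Lemma GammaE x : Gamma x = fine (euler_integral x).
Proof. by []. Qed.

Lemma gamma_integrand_ge0 x t : 0 <= gamma_integrand x t.
Proof. by rewrite mulr_ge0 ?powR_ge0 ?expR_ge0. Qed.

Lemma measurable_gamma_integrand x D :
  measurable_fun D (gamma_integrand x).
Proof.
apply: measurable_funTS; apply: measurable_funM; first exact: measurable_powR.
by apply: measurableT_comp => //; exact: measurableT_comp.
Qed.

Lemma measurable_EFin_gamma_integrand x D :
  measurable_fun D (EFin \o gamma_integrand x).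
Proof. by apply/measurable_EFinP; exact: measurable_gamma_integrand. Qed.

Lemma euler_integral_ge0 x : (0 <= euler_integral x)%E.
Proof. by apply: integral_ge0 => t _; rewrite lee_fin gamma_integrand_ge0. Qed.

Lemma euler_integral1 : euler_integral 1 = 1%E.
Proof.
rewrite /euler_integral integral_itv_obnd_cbnd; last first.
  exact: measurable_EFin_gamma_integrand.
rewrite -(@integral_exponential_pdf R 1)// /exponential_pdf.
rewrite integral_mkcond; apply: eq_integral => t _ /=; rewrite !patchE.
by case: ifP => // _; rewrite /gamma_integrand subrr powRr0 !mul1r mulN1r.
Qed.

(** Bernoulli's inequality at z = t / u, read as the convexity of exp on the
    segment from 0 to ln z. *)
Lemma powR_le_affine (u s t : R) : 0 < u -> 0 < t -> 0 <= s <= 1 ->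
  t `^ s <= u `^ s * (1 - s + s * (t / u)).
Proof.
move=> u0 t0 /andP[s0 s1].
have tu0 : 0 < t / u by rewrite divr_gt0.
have -> : t `^ s = u `^ s * (t / u) `^ s.
  by rewrite -powRM ?ltW//; congr (_ `^ _); rewrite mulrCA divff ?mulr1// gt_eqF.
rewrite ler_pM2l ?powR_gt0//.
have := convex_expR (Itv01 s0 s1) (ln (t / u)) 0.
rewrite !convRE /= !lnK ?posrE// mulr0 addr0 expR0 mulr1 /powR gt_eqF//.
by rewrite addrC.
Qed.

Lemma gamma_integrand_shift x s t : 0 < t ->
  gamma_integrand (x + s) t = t `^ s * gamma_integrand x t.
Proof.
move=> t0; rewrite /gamma_integrand mulrA -powRD ?(gt_eqF t0) ?implybT//.
by congr (_ `^ _ * _); ring.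
Qed.

(** Weighting Bernoulli's inequality by the integrand of Gamma(u) and integrating
    makes its affine side collapse: the mean of t is Gamma(u+1)/Gamma(u) = u. *)
Lemma euler_integral_wendel u s : 0 < u -> 0 <= s <= 1 ->
  euler_integral (u + 1) = (u%:E * euler_integral u)%E ->
  (euler_integral (u + s) <= (u `^ s)%:E * euler_integral u)%E.
Proof.
move=> u0 s01 Eu1; have /andP[s0 s1] := s01.
have c1 : 0 <= 1 - s by rewrite subr_ge0.
have c2 : 0 <= s / u by rewrite divr_ge0// ltW.
have -> : (euler_integral u =
    (1 - s)%:E * euler_integral u + (s / u)%:E * euler_integral (u + 1))%E.
  rewrite Eu1 muleA -EFinM divfK ?gt_eqF// -ge0_muleDl// ?lee_fin//.
  by rewrite -EFinD subrK mul1e.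
rewrite /euler_integral.
rewrite -!ge0_integralZl_EFin//=; do ?[exact: measurable_EFin_gamma_integrand
  | by move=> *; rewrite lee_fin gamma_integrand_ge0 | exact: measurable_itv].
rewrite -ge0_integralD//=; do ?[by apply: measurable_funeM; exact: measurable_EFin_gamma_integrand
  | by move=> *; rewrite -EFinM lee_fin mulr_ge0// gamma_integrand_ge0].
rewrite -ge0_integralZl_EFin ?powR_ge0//=; do ?[
   by apply: emeasurable_funD; apply: measurable_funeM; exact: measurable_EFin_gamma_integrand
  | by move=> *; rewrite -!EFinM -EFinD lee_fin addr_ge0// mulr_ge0// gamma_integrand_ge0].
apply: ge0_le_integral => //=.
- by move=> *; rewrite lee_fin gamma_integrand_ge0.
- exact: measurable_EFin_gamma_integrand.
- by apply: measurable_funeM; apply: emeasurable_funD;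
    apply: measurable_funeM; exact: measurable_EFin_gamma_integrand.
move=> t; rewrite in_itv/= andbT => t0.
rewrite -!EFinM lee_fin !gamma_integrand_shift// (powRr1 (ltW t0)).
have -> : u `^ s * ((1 - s) * gamma_integrand u t + s / u * (t * gamma_integrand u t))
  = u `^ s * (1 - s + s * (t / u)) * gamma_integrand u t by ring.
by rewrite ler_wpM2r ?gamma_integrand_ge0// powR_le_affine.
Qed.

Lemma powR_expRN_cvg_at_right x : 0 < x ->
  t `^ x * expR (- t) @[t --> 0^'+] --> 0.
Proof.
move=> x0; rewrite -[X in _ --> X](mul0r (expR (- (0 : R)))).
apply: cvgM; first exact: powR_cvg0.
apply: cvg_at_right_filter; apply: continuous_comp; last exact: continuous_expR.
exact: opp_continuous.
Qed.

(** The factor e^(-t/2) absorbs the power: u < e^u at u = t/(2x) gives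
    t^x <= (2x)^x e^(t/2). *)
Lemma powR_expRN_cvgy x : 0 < x ->
  t `^ x * expR (- t) @[t --> +oo%R] --> 0.
Proof.
move=> x0.
have e0 : (x *+ 2) `^ x * expR (- (2^-1 * t)) @[t --> +oo] --> 0.
  rewrite -[X in _ --> X](mulr0 ((x *+ 2) `^ x)).
  apply: cvgMr; apply: (@cvg_comp _ _ _ (fun t => 2^-1 * t)
    (fun t => expR (- t)) _ (pinfty_nbhs R)); last exact: cvgr_expR.
  by apply: gt0_cvgMry => //; rewrite invr_gt0.
apply: (squeeze_cvgr _ (cvg_cst 0) e0); near=> t.
have t0 : 0 < t by near: t; exact: nbhs_pinfty_gt.
rewrite mulr_ge0 ?powR_ge0 ?expR_ge0//=.
have x2 : 0 < x *+ 2 by rewrite pmulrn_lgt0.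
have -> : t `^ x = (x *+ 2) `^ x * (t / (x *+ 2)) `^ x.
  rewrite -powRM ?ltW// ?divr_gt0//; congr (_ `^ _).
  by rewrite mulrCA divff ?mulr1// gt_eqF.
rewrite -mulrA ler_wpM2l ?powR_ge0// (@le_trans _ _ (expR (2^-1 * t) * expR (- t)))//.
  rewrite ler_wpM2r ?expR_ge0//.
  have -> : 2^-1 * t = t / (x *+ 2) * x by rewrite -mulr_natr; field; rewrite gt_eqF.
  rewrite expRM ge0_ler_powR ?nnegrE ?ltW ?expR_gt0 ?divr_gt0//.
  by rewrite (lt_le_trans _ (expR_ge1Dx _))// ltrDr.
by rewrite -expRD ler_expR; lra.
Unshelve. all: by end_near. Qed.

Lemma continuous_powR_pos x t : 0 < t -> {for t, continuous (powR (R:=R) ^~ x)}.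
Proof.
move=> t0; apply: differentiable_continuous; apply/derivable1_diffP.
by apply: derivable_powR; rewrite in_itv/= andbT.
Qed.

Lemma continuous_expRN t : {for t, continuous (fun t : R => expR (- t))}.
Proof. by apply: continuous_comp; [exact: opp_continuous|exact: continuous_expR]. Qed.

Lemma within_continuous_pos (f : R -> R) (a b : R) : 0 < a ->
  (forall t, 0 < t -> {for t, continuous f}) -> {within `[a, b], continuous f}.
Proof.
move=> a0 cf; apply: continuous_in_subspaceT => t; rewrite inE/= in_itv/= => /andP[ta _].
by apply: cf; exact: lt_le_trans ta.
Qed.

(** Integration by parts; for x < 1 the integrand is unbounded at 0, so the
    interval has to stay away from 0 as well as from +oo. *)
Lemma euler_integralS_itv x (a b : R) : 0 < x -> 0 < a -> a < b ->
  (\int[mu]_(t in `[a, b]) (gamma_integrand (x + 1) t)%:E =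
   (a `^ x * expR (- a) - b `^ x * expR (- b))%:E +
   x%:E * \int[mu]_(t in `[a, b]) (gamma_integrand x t)%:E)%E.
Proof.
move=> x0 a0 ab; have b0 := lt_trans a0 ab.
under eq_integral => t _ do rewrite /gamma_integrand addrK.
have dN (t : R) : is_derive t 1 (fun t => - expR (- t)) (expR (- t)).
  by apply: is_derive_eq; rewrite mulrN1 opprK.
rewrite (@integration_by_parts _ (fun t => t `^ x) (fun t => - expR (- t))
  (fun t => x * t `^ (x - 1)) (fun t => expR (- t)))//; last 1 first.
- by move=> t _; rewrite derive1E derive_val.
- have -> : (b `^ x * - expR (- b) - a `^ x * - expR (- a) =
     a `^ x * expR (- a) - b `^ x * expR (- b)) by ring.
  congr (_ + _)%E; rewrite -ge0_integralZl_EFin ?ltW//; last 2 first.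
  + by move=> *; rewrite lee_fin gamma_integrand_ge0.
  + exact: measurable_EFin_gamma_integrand.
  transitivity (- \int[mu]_(t in `[a, b]) - (x%:E * (gamma_integrand x t)%:E))%E.
    by congr (- _)%E; apply: eq_integral => t _; rewrite -EFinM -EFinN mulrN mulrA.
  rewrite integral_ge0N ?oppeK// => t _.
  by rewrite -EFinM lee_fin mulr_ge0 ?gamma_integrand_ge0 ?ltW.
- apply: within_continuous_pos => // t t0; apply: continuousM; first exact: cst_continuous.
  exact: continuous_powR_pos.
- split.
  + by move=> t; rewrite in_itv/= => /andP[ta _]; apply: derivable_powR;
      rewrite in_itv/= andbT (lt_trans a0).
  + by apply: cvg_at_right_filter; exact: continuous_powR_pos.
  + by apply: cvg_at_left_filter; exact: continuous_powR_pos.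
- move=> t; rewrite in_itv/= => /andP[ta _].
  by rewrite powR_derive1// in_itv/= andbT (lt_trans a0).
- by apply: within_continuous_pos => // t _; exact: continuous_expRN.
- split.
  + by move=> t _; exact: ex_derive.
  + by apply: cvg_at_right_filter; apply: cvgN; exact: continuous_expRN.
  + by apply: cvg_at_left_filter; apply: cvgN; exact: continuous_expRN.
Qed.

Lemma cvgS (T : ptopologicalType) (u : nat -> T) (F : set_system T) :
  u n @[n --> \oo] --> F -> u n.+1 @[n --> \oo] --> F.
Proof. by rewrite (cvg_shiftS u). Qed.

(** Exhausting (0, +oo) by the intervals [1/(n+2), n+2] makes both integrals
    converge by monotone convergence, and the boundary terms vanish. *)
Lemma euler_integralS x : 0 < x ->
  euler_integral (x + 1) = (x%:E * euler_integral x)%E.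
Proof.
move=> x0.
pose F n : set R := `[n.+2%:R^-1, n.+2%:R]%classic.
have F0 n : 0 < n.+2%:R^-1 :> R by rewrite invr_gt0.
have F1 n : n.+2%:R^-1 < n.+2%:R :> R.
  by rewrite (@lt_trans _ _ 1) ?invf_lt1 ?ltr1n.
have UF : \bigcup_n F n = `]0, +oo[%classic.
  apply/seteqP; split => [t [n _]|t]; rewrite /F/= !in_itv/= ?andbT.
    by move=> /andP[+ _]; exact: lt_le_trans.
  move=> t0; pose N := maxn (Num.truncn t) (Num.truncn t^-1); exists N => //=.
  rewrite in_itv/=; apply/andP; split; last first.
    rewrite (le_trans (ltW (truncnS_gt _)))// ler_nat ltnS.
    exact: leq_trans (leq_maxl _ _) (leqnSn _).
  rewrite -[leRHS]invrK lef_pV2 ?posrE ?invr_gt0//.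
  rewrite (le_trans (ltW (truncnS_gt _)))// ler_nat ltnS.
  exact: leq_trans (leq_maxr _ _) (leqnSn _).
have ndF : nondecreasing_seq F.
  move=> m n mn; rewrite subsetEset => t; rewrite /F/= !in_itv/= => /andP[mt tm].
  rewrite (le_trans _ mt) ?(le_trans tm)// ?ler_nat ?ltnS//.
  by rewrite lef_pV2 ?posrE// ler_nat.
have cvgF y : (\int[mu]_(t in F n) (gamma_integrand y t)%:E @[n --> \oo] -->
    euler_integral y)%E.
  rewrite /euler_integral -UF.
  apply: (@ge0_nondecreasing_set_cvg_integral _ (measurableTypeR R) _ F _ mu) => //.
  - by move=> n; exact: measurable_itv.
  - by move=> n; exact: measurable_EFin_gamma_integrand.
  - by move=> *; rewrite lee_fin gamma_integrand_ge0.
have cvg_bd : (n.+2%:R^-1 `^ x * expR (- n.+2%:R^-1) - n.+2%:R `^ x * expR (- n.+2%:R))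
    @[n --> \oo] --> (0 : R).
  rewrite -[X in _ --> X](subr0 (0 : R)); apply: cvgB.
    have /cvg_at_rightP/(_ (fun n => n.+2%:R^-1)) := powR_expRN_cvg_at_right x0.
    apply; split => //.
    exact: (cvgS (@cvg_harmonic R)).
  have /cvg_pinftyP/(_ (fun n => n.+2%:R)) := powR_expRN_cvgy x0; apply.
  exact: (cvgS (cvgS (@cvgr_idn R))).
pose v n := ((n.+2%:R^-1 `^ x * expR (- n.+2%:R^-1) - n.+2%:R `^ x * expR (- n.+2%:R))%:E +
    x%:E * \int[mu]_(t in F n) (gamma_integrand x t)%:E)%E.
have cvg_v : v n @[n --> \oo] --> (x%:E * euler_integral x)%E.
  rewrite -[X in _ --> X]add0e; apply: cvgeD; first by [].
    by apply: cvg_EFin => //; exact: nearW.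
  by apply: cvgeZl => //; exact: cvgF.
have := cvgF (x + 1); rewrite (_ : (fun n => _) = v); last first.
  by apply/funext => n; rewrite /F euler_integralS_itv.
move=> cvg_v2; rewrite -(cvg_lim (@ereal_hausdorff R) cvg_v2).
exact: (cvg_lim (@ereal_hausdorff R) cvg_v).
Qed.
End EulerIntegral.

(** * The Gamma function and the slopes of its logarithm *)

Section GammaFunction.
Set Implicit Arguments.
Unset Strict Implicit.
Unset Printing Implicit Defensive.
Context {R : realType}.
Implicit Types x s t u v : R.

(** At integers this is the factorial recursion.  In between, Wendel's inequality
    bounds Gamma(m+1+s) by a multiple of Gamma(m+1), and Gamma(m+2) by a
    multiple of Gamma(m+1+s), which is thus positive; the functional equation then
    descends from x + 1 to x. *)
Lemma euler_integral_gt0_lty x : 0 < x -> (0 < euler_integral x < +oo)%E.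
Proof.
have nat_case n : (0 < euler_integral (n.+1%:R : R) < +oo)%E.
  elim: n => [|n /andP[IH1 IH2]]; first by rewrite euler_integral1 lte01 ltry.
  rewrite -(@natr1 R n.+1) euler_integralS//.
  by rewrite mule_gt0 ?lte_fin//= lte_mul_pinfty ?lee_fin.
move=> x0; have xE : (euler_integral (x + 1) = x%:E * euler_integral x)%E.
  exact: euler_integralS.
have x_fin : (0 < euler_integral (x + 1) < +oo)%E.
  have /andP[mx xm] := truncn_itv (ltW x0).
  set m := Num.truncn x in mx xm.
  have x1E : x + 1 = m.+1%:R + (x - m%:R) by rewrite -natr1; ring.
  have s01 : 0 <= x - m%:R <= 1.
    by rewrite subr_ge0 mx/= lerBlDl natr1 ltW.
  have /andP[m0 moo] := nat_case m.
  have m1E : (euler_integral (m.+1%:R + 1) = m.+1%:R%:E * euler_integral (m.+1%:R : R))%E.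
    exact: euler_integralS.
  apply/andP; split; last first.
    rewrite x1E (le_lt_trans (euler_integral_wendel _ s01 m1E))//.
    by rewrite lte_mul_pinfty ?lee_fin ?powR_ge0.
  have x1E' : (euler_integral (x + 1 + 1) = (x + 1)%:E * euler_integral (x + 1))%E.
    by apply: euler_integralS; rewrite addr_gt0.
  have s01' : 0 <= 1 - (x - m%:R) <= 1 by lra.
  have x1_gt0 : 0 < x + 1 by rewrite addr_gt0.
  have := euler_integral_wendel x1_gt0 s01' x1E'.
  rewrite (_ : _ + (1 - _) = m.+2%:R); last by rewrite -!natr1; ring.
  have /andP[m20 _] := nat_case m.+1 => /(lt_le_trans m20) h.
  rewrite lt_neqAle euler_integral_ge0 andbT; apply: contraTneq h => <-.
  by rewrite mule0 ltxx.
move: x_fin; rewrite xE; have := euler_integral_ge0 x.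
case: (euler_integral x) => [r| |]//= _.
  by rewrite -EFinM !lte_fin pmulr_rgt0// => /andP[-> _]; rewrite ltry.
by rewrite gt0_muley ?lte_fin// ltxx andbF.
Qed.

Lemma Gamma_gt0 x : 0 < x -> 0 < Gamma x.
Proof. by move=> /euler_integral_gt0_lty; exact: fine_gt0. Qed.

Lemma euler_integralE x : 0 < x -> euler_integral x = (Gamma x)%:E.
Proof.
move=> /euler_integral_gt0_lty /andP[? ?]; rewrite GammaE fineK//.
by rewrite ge0_fin_numE ?euler_integral_ge0.
Qed.

Lemma GammaS x : 0 < x -> Gamma (x + 1) = x * Gamma x.
Proof.
move=> x0; apply: EFin_inj; rewrite EFinM -!euler_integralE ?addr_gt0//.
exact: euler_integralS.
Qed.

Lemma Gamma_wendel x s : 0 < x -> 0 <= s <= 1 -> Gamma (x + s) <= x `^ s * Gamma x.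
Proof.
move=> x0 s01; have /andP[s0 _] := s01.
rewrite -lee_fin EFinM -!euler_integralE ?ltr_pwDl//.
exact/euler_integral_wendel/euler_integralS.
Qed.

Definition lnGamma x := ln (Gamma x).

Lemma lnGammaS x : 0 < x -> lnGamma (x + 1) = lnGamma x + ln x.
Proof.
by move=> x0; rewrite /lnGamma GammaS// lnM ?posrE ?Gamma_gt0// addrC.
Qed.

Lemma ln_sub_bounds u v : 0 < u -> 0 < v ->
  (v - u) / v <= ln v - ln u <= (v - u) / u.
Proof.
have ub (a b : R) : 0 < a -> 0 < b -> ln b - ln a <= (b - a) / a.
  move=> a0 b0; rewrite -ln_div ?posrE//.
  have -> : b / a = 1 + (b - a) / a by field; rewrite gt_eqF.
  apply: le_ln1Dx.
  by rewrite ltr_pdivlMr// mulN1r; lra.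
move=> u0 v0; rewrite ub// andbT.
have := ub v u v0 u0; rewrite -[leRHS]opprK lerNr opprB -mulNr opprB//.
Qed.

Lemma lnGamma_slope_le x s : 0 < x -> 0 <= s <= 1 ->
  lnGamma (x + s) - lnGamma x <= s * ln x.
Proof.
move=> x0 s01; have /andP[s0 s1] := s01.
rewrite lerBlDr /lnGamma -ln_powR -lnM ?posrE ?powR_gt0 ?Gamma_gt0//.
by rewrite ler_ln ?posrE ?mulr_gt0 ?powR_gt0 ?Gamma_gt0 ?ltr_pwDl// Gamma_wendel.
Qed.

(** Wendel's inequality from x + s up to x + 1 = (x + s) + (1 - s). *)
Lemma lnGamma_slope_ge x s : 0 < x -> 0 <= s <= 1 ->
  s * (ln x - x^-1) <= lnGamma (x + s) - lnGamma x.
Proof.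
move=> x0 s01; have /andP[s0 s1] := s01.
have xs0 : 0 < x + s by rewrite ltr_pwDl.
have s01' : 0 <= 1 - s <= 1 by lra.
have := lnGamma_slope_le xs0 s01'.
rewrite (_ : x + s + (1 - s) = x + 1); last by ring.
rewrite lnGammaS// => h.
have /andP[_ h2] := ln_sub_bounds x0 xs0.
have h3 : (1 - s) * (ln (x + s) - ln x) <= s * x^-1.
  apply: (@le_trans _ _ (1 * (ln (x + s) - ln x))).
    rewrite ler_wpM2r//; last by rewrite gerBl.
    by rewrite subr_ge0 ler_ln ?posrE// lerDl.
  by rewrite mul1r (le_trans h2)// addrAC subrr add0r.
move: h h3; move: (lnGamma (x + s)) (lnGamma x) (ln (x + s)) (ln x) (x^-1).
by move=> a b c d i h h3; clear - h h3; lra.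
Qed.
End GammaFunction.

(** * Differentiability of ln Gamma and the digamma function *)

Section Digamma.
Set Implicit Arguments.
Unset Strict Implicit.
Unset Printing Implicit Defensive.
Context {R : realType}.
Implicit Types x u v c e : R.

Definition harmonic_sum (N : nat) x : R := \sum_(k < N) (x + k%:R)^-1.

Definition digamma_seq x (N : nat) : R := ln (x + N%:R) - harmonic_sum N x.

Definition digamma_lim x : R := limn (digamma_seq x).

Lemma addr_nat_gt0 x (k : nat) : 0 < x -> 0 < x + k%:R.
Proof. by move=> x0; rewrite ltr_pwDl. Qed.

Lemma harmonic_sumS N x : harmonic_sum N.+1 x = harmonic_sum N x + (x + N%:R)^-1.
Proof. by rewrite /harmonic_sum big_ord_recr. Qed.

(** The functional equation moves u and v to u + N and v + N, where the slope is
    known up to 1/(u+N); the price is a sum of slopes of ln, and each of these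
    lies between 1/(v+k) and 1/(u+k). *)
Lemma lnGamma_slope_bounds (N : nat) u v : 0 < u -> u <= v <= u + 1 ->
  (v - u) * (digamma_seq u N - (u + N%:R)^-1) <= lnGamma v - lnGamma u
    <= (v - u) * digamma_seq v N.
Proof.
move=> u0 /andP[uv vu]; have v0 : 0 < v by exact: lt_le_trans uv.
have vu0 : 0 <= v - u by rewrite subr_ge0.
suff : (v - u) * (ln (u + N%:R) - (u + N%:R)^-1 - harmonic_sum N u) <=
    lnGamma v - lnGamma u <= (v - u) * (ln (u + N%:R) - harmonic_sum N v).
  move=> /andP[h1 h2]; apply/andP; split.
    by apply: le_trans h1; rewrite /digamma_seq addrAC.
  apply: (le_trans h2); rewrite ler_wpM2l// /digamma_seq lerD2r.
  by rewrite ler_ln ?posrE ?addr_nat_gt0// lerD2r.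
have shift x : 0 < x -> lnGamma (x + N%:R) = lnGamma x + \sum_(k < N) ln (x + k%:R).
  move=> x0; elim: N => [|N IH]; first by rewrite big_ord0 !addr0.
  rewrite big_ord_recr/= addrA -IH -natr1 addrA lnGammaS ?addr_nat_gt0//.
have sumE : lnGamma v - lnGamma u = (lnGamma (v + N%:R) - lnGamma (u + N%:R)) -
    \sum_(k < N) (ln (v + k%:R) - ln (u + k%:R)).
  rewrite !shift// sumrB; move: (lnGamma v) (lnGamma u) (\sum_(k < N) _) (\sum_(k < N) _).
  by move=> a b c d; ring.
have vuk k : v + k%:R - (u + k%:R) = v - u by rewrite opprD addrACA subrr addr0.
have s01 : 0 <= v - u <= 1 by rewrite vu0 lerBlDl.
have uN0 := addr_nat_gt0 N u0.
have vE : v + N%:R = u + N%:R + (v - u) by rewrite addrAC (addrC u) subrK.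
have := lnGamma_slope_le uN0 s01; have := lnGamma_slope_ge uN0 s01.
rewrite -vE => h1 h2.
have s1 : \sum_(k < N) (ln (v + k%:R) - ln (u + k%:R)) <= (v - u) * harmonic_sum N u.
  rewrite mulr_sumr; apply: ler_sum => k _.
  have /andP[_] := ln_sub_bounds (addr_nat_gt0 k u0) (addr_nat_gt0 k v0).
  by rewrite vuk.
have s2 : (v - u) * harmonic_sum N v <= \sum_(k < N) (ln (v + k%:R) - ln (u + k%:R)).
  rewrite mulr_sumr; apply: ler_sum => k _.
  have /andP[+ _] := ln_sub_bounds (addr_nat_gt0 k u0) (addr_nat_gt0 k v0).
  by rewrite vuk.
rewrite sumE (mulrBr _ _ (harmonic_sum N u)) (mulrBr _ _ (harmonic_sum N v)).
by rewrite lerB// lerB.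
Qed.

Lemma digamma_seq_nincr x : 0 < x -> nonincreasing_seq (digamma_seq x).
Proof.
move=> x0; apply/nonincreasing_seqP => N.
rewrite /digamma_seq harmonic_sumS -natr1 addrA.
have xN0 := addr_nat_gt0 N x0.
have /andP[_] := ln_sub_bounds xN0 (addr_gt0 xN0 ltr01).
rewrite (addrC (x + _) 1) addrK mul1r.
move: (ln _) (ln _) (harmonic_sum N x) (_^-1) => a b c d; lra.
Qed.

(** The sequence decreases, and it is bounded below by the slope of ln Gamma on
    any segment of length at most 1 ending at x. *)
Lemma digamma_seq_cvg x : 0 < x -> digamma_seq x @ \oo --> digamma_lim x.
Proof.
move=> x0; apply: nonincreasing_is_cvgn; first exact: digamma_seq_nincr.
pose s := x / (1 + x).
have x10 : 0 < 1 + x by rewrite addr_gt0.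
have s0 : 0 < s by rewrite divr_gt0.
have s1 : s <= 1 by rewrite ler_pdivrMr// mul1r; lra.
have u0 : 0 < x - s.
  rewrite (_ : x - s = x ^+ 2 / (1 + x)); first by rewrite divr_gt0// exprn_gt0.
  by rewrite /s; field; rewrite gt_eqF.
have b01 : x - s <= x <= x - s + 1 by lra.
exists ((lnGamma x - lnGamma (x - s)) / s) => _ [N _ <-].
rewrite ler_pdivrMr// mulrC.
have /andP[_] := lnGamma_slope_bounds N u0 b01.
by rewrite subKr.
Qed.

Lemma invr_nat_cvg0 x : 0 < x -> (x + n%:R)^-1 @[n --> \oo] --> (0 : R).
Proof.
move=> x0; apply/(gtr0_cvgV0 _).2.
  by apply: nearW => n; exact: addr_nat_gt0.
apply/cvgryPge => A; near=> n.
have : A <= n%:R by near: n; exact: nbhs_infty_ger.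
by move=> /le_trans; apply; rewrite lerDr ltW.
Unshelve. all: by end_near. Qed.

Lemma lnGamma_slope_digamma u v : 0 < u -> u <= v <= u + 1 ->
  (v - u) * digamma_lim u <= lnGamma v - lnGamma u <= (v - u) * digamma_lim v.
Proof.
move=> u0 uv; have v0 : 0 < v by have /andP[+ _] := uv; exact: lt_le_trans.
have b N := lnGamma_slope_bounds N u0 uv.
apply/andP; split.
  have : (v - u) * (digamma_seq u n - (u + n%:R)^-1) @[n --> \oo] -->
      (v - u) * (digamma_lim u - 0).
    apply: cvgMr; apply: cvgB; [exact: digamma_seq_cvg|exact: invr_nat_cvg0].
  rewrite subr0 => h; apply: (ler_cvg_to h (cvg_cst _)).
  by apply: nearW => n; have /andP[] := b n.
have : (v - u) * digamma_seq v n @[n --> \oo] --> (v - u) * digamma_lim v.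
  apply: cvgMr; exact: digamma_seq_cvg.
move=> h; apply: (ler_cvg_to (cvg_cst _) h).
by apply: nearW => n; have /andP[] := b n.
Qed.

End Digamma.

(** * Slopes of the digamma function *)

Section Trigamma.
Set Implicit Arguments.
Unset Strict Implicit.
Unset Printing Implicit Defensive.
Context {R : realType}.
Implicit Types x u v c e : R.

Definition trigamma_seq x (N : nat) : R := \sum_(k < N) (x + k%:R) ^- 2.

Definition trigamma x : R := limn (trigamma_seq x).

Lemma trigamma_seqS x N : trigamma_seq x N.+1 = trigamma_seq x N + (x + N%:R) ^- 2.
Proof. by rewrite /trigamma_seq big_ord_recr. Qed.

Lemma trigamma_seq_ndecr x : nondecreasing_seq (trigamma_seq x).
Proof.
apply/nondecreasing_seqP => N; rewrite trigamma_seqS lerDl.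
by rewrite invr_ge0 sqr_ge0.
Qed.

Lemma trigamma_seq_cvg x : 0 < x -> trigamma_seq x @ \oo --> trigamma x.
Proof.
move=> x0; apply: nondecreasing_is_cvgn; first exact: trigamma_seq_ndecr.
have ub N : trigamma_seq x N.+1 <= x ^- 2 + x^-1 - (x + N%:R)^-1.
  elim: N => [|N IH].
    by rewrite /trigamma_seq big_ord_recr big_ord0/= add0r addr0 addrK.
  rewrite trigamma_seqS; move: IH; have xN := addr_nat_gt0 N x0.
  have xN1 := addr_nat_gt0 N.+1 x0.
  have : (x + N.+1%:R) ^- 2 <= (x + N%:R)^-1 - (x + N.+1%:R)^-1.
    have -> : (x + N%:R)^-1 - (x + N.+1%:R)^-1 = (x + N%:R)^-1 * (x + N.+1%:R)^-1.
      by rewrite -natr1 addrA; field; rewrite !gt_eqF// addr_gt0.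
    rewrite expr2 invfM ler_wpM2r ?invr_ge0 ?(ltW xN1)// lef_pV2 ?posrE//.
    by rewrite -natr1; lra.
  lra.
exists (x ^- 2 + x^-1) => _ [N _ <-].
have /le_trans := trigamma_seq_ndecr x (leqnSn N); apply; apply: (le_trans (ub N)).
by rewrite gerBl invr_ge0 ltW// addr_nat_gt0.
Qed.

Lemma trigamma_gt0 x : 0 < x -> 0 < trigamma x.
Proof.
move=> x0; have h := nondecreasing_cvgn_le (@trigamma_seq_ndecr x) (trigamma_seq_cvg x0).
apply: lt_le_trans (h 1%N).
by rewrite /trigamma_seq big_ord_recr big_ord0/= add0r addr0 invr_gt0 exprn_gt0.
Qed.

Lemma digamma_seqB u v N : 0 < u -> 0 < v ->
  digamma_seq v N - digamma_seq u N = (ln (v + N%:R) - ln (u + N%:R)) +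
    (v - u) * \sum_(k < N) ((u + k%:R) * (v + k%:R))^-1.
Proof.
move=> u0 v0; rewrite /digamma_seq.
suff -> : (v - u) * \sum_(k < N) ((u + k%:R) * (v + k%:R))^-1 =
    harmonic_sum N u - harmonic_sum N v by ring.
rewrite /harmonic_sum -sumrB mulr_sumr; apply: eq_bigr => k _.
by field; rewrite !gt_eqF// addr_nat_gt0.
Qed.

(** Every term of sum_k 1/((u+k)(v+k)) compares with 1/(c+k)^2, since
    (1-e)(c+k) <= (1-e)c + k and (1+e)c + k <= (1+e)(c+k). *)
Lemma digamma_lim_slope c e u v : 0 < c -> 0 <= e < 1 ->
  c * (1 - e) <= u -> u <= v -> v <= c * (1 + e) ->
  (v - u) * ((1 + e) ^- 2 * trigamma c) <= digamma_lim v - digamma_lim u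
    <= (v - u) * ((1 - e) ^- 2 * trigamma c).
Proof.
move=> c0 /andP[e0 e1] cu uv vc.
have e1' : 0 < 1 - e by lra.
have e2' : 0 < 1 + e by lra.
have u0 : 0 < u by apply: lt_le_trans cu; rewrite mulr_gt0.
have v0 := lt_le_trans u0 uv.
have vu0 : 0 <= v - u by rewrite subr_ge0.
have cvgB : digamma_seq v N - digamma_seq u N @[N --> \oo] -->
    digamma_lim v - digamma_lim u.
  by apply: cvgB; exact: digamma_seq_cvg.
have cvgT a : (v - u) * (a * trigamma_seq c N) @[N --> \oo] -->
    (v - u) * (a * trigamma c).
  by apply: cvgMr; apply: cvgMr; exact: trigamma_seq_cvg.
have scale_lo a k : 0 < a -> a <= c * (1 + e) -> a + k%:R <= (1 + e) * (c + k%:R).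
  move=> a0 ac; have : 0 <= e * k%:R :> R by rewrite mulr_ge0.
  lra.
have scale_hi a k : c * (1 - e) <= a -> (1 - e) * (c + k%:R) <= a + k%:R.
  move=> ac; have : 0 <= e * k%:R :> R by rewrite mulr_ge0.
  lra.
apply/andP; split.
  apply: (ler_cvg_to (cvgT _) cvgB); apply: nearW => N.
  rewrite digamma_seqB// ler_wpDl//.
    by rewrite subr_ge0 ler_ln ?posrE ?addr_nat_gt0// lerD2r.
  rewrite ler_wpM2l// mulr_sumr; apply: ler_sum => k _.
  have uk := addr_nat_gt0 k u0; have vk := addr_nat_gt0 k v0.
  have ck := addr_nat_gt0 k c0.
  rewrite -invfM lef_pV2 ?posrE ?mulr_gt0// ?exprn_gt0//.
  rewrite expr2 expr2 mulrACA ler_pM ?(ltW uk) ?(ltW vk) ?scale_lo//.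
  exact: le_trans vc.
have cvgR : (v - u) * ((1 - e) ^- 2 * trigamma_seq c N) + (v - u) * (u + N%:R)^-1
    @[N --> \oo] --> (v - u) * ((1 - e) ^- 2 * trigamma c) + (v - u) * 0.
  by apply: cvgD; [exact: cvgT|apply: cvgMr; exact: invr_nat_cvg0].
rewrite mulr0 addr0 in cvgR.
apply: (ler_cvg_to cvgB cvgR); apply: nearW => N.
rewrite digamma_seqB// addrC lerD//.
  rewrite ler_wpM2l// mulr_sumr; apply: ler_sum => k _.
  have uk := addr_nat_gt0 k u0; have vk := addr_nat_gt0 k v0.
  have ck := addr_nat_gt0 k c0.
  rewrite -invfM lef_pV2 ?posrE ?mulr_gt0// ?exprn_gt0//.
  rewrite expr2 expr2 mulrACA ler_pM ?mulr_ge0 ?(ltW e1') ?(ltW ck) ?scale_hi//.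
  exact: le_trans uv.
have /andP[_] := ln_sub_bounds (addr_nat_gt0 N u0) (addr_nat_gt0 N v0).
by rewrite opprD addrACA subrr addr0.
Qed.

(** The increment of ln Gamma lies between (y-x) psi(x) and (y-x) psi(y), and
    psi(y) - psi(x) is itself O(y-x); the constant is the slope bound for
    e = 1/2. *)
Lemma lnGamma_quadratic x y : 0 < x -> `|y - x| <= x / 2 -> `|y - x| <= 1 ->
  `|lnGamma y - lnGamma x - (y - x) * digamma_lim x| <=
  `|y - x| ^+ 2 * ((1 - 2^-1) ^- 2 * trigamma x).
Proof.
move=> x0; set T := (_ ^- 2 * _).
have e1 : 0 <= (2^-1 : R) < 1 by apply/andP; split; lra.
have lo : x * (1 - 2^-1) <= x by lra.
have hi : x <= x * (1 + 2^-1) by lra.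
case: (leP x y) => [xy|/ltW yx].
  rewrite ger0_norm ?subr_ge0// => h1 h2.
  have yx1 : x <= y <= x + 1 by rewrite xy/= addrC -lerBlDr.
  have y_hi : y <= x * (1 + 2^-1) by lra.
  have /andP[b1 b2] := lnGamma_slope_digamma x0 yx1.
  have /andP[_ b3] := digamma_lim_slope x0 e1 lo xy y_hi.
  rewrite ger0_norm ?subr_ge0// lerBlDr (le_trans b2)// -lerBlDr -mulrBr.
  by rewrite expr2 -mulrA ler_wpM2l// subr_ge0.
rewrite distrC ger0_norm ?subr_ge0// => h1 h2.
have y0 : 0 < y by lra.
have yx1 : y <= x <= y + 1 by rewrite yx/= addrC -lerBlDr.
have y_lo : x * (1 - 2^-1) <= y by lra.
have /andP[b1 b2] := lnGamma_slope_digamma y0 yx1.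
have /andP[_ b3] := digamma_lim_slope x0 e1 y_lo yx hi.
have -> : lnGamma y - lnGamma x - (y - x) * digamma_lim x =
    (x - y) * digamma_lim x - (lnGamma x - lnGamma y).
  by move: (lnGamma x) (lnGamma y) (digamma_lim x) => a b c; ring.
rewrite ger0_norm ?subr_ge0// lerBlDl -lerBlDr; apply: le_trans b1.
by rewrite lerBlDr -lerBlDl -mulrBr expr2 -mulrA ler_wpM2l// subr_ge0.
Qed.

Lemma is_derive_lnGamma x : 0 < x -> is_derive x 1 (@lnGamma R) (digamma_lim x).
Proof.
move=> x0; set T := (1 - 2^-1) ^- 2 * trigamma x.
suff cvg_slope : h^-1 *: ((@lnGamma R \o shift x) (h *: 1) - lnGamma x)
    @[h --> 0^'] --> digamma_lim x.
  apply: DeriveDef; first by apply/cvg_ex; exists (digamma_lim x).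
  exact: cvg_lim.
have T1 : 0 < T + 1.
  by rewrite ltr_pwDr// mulr_ge0 ?invr_ge0 ?sqr_ge0// ltW// trigamma_gt0.
apply/cvgrPdist_le => /= e e0.
near=> h.
have h0 : h != 0 by near: h; exact: nbhs_dnbhs_neq.
have hx2 : `|h| <= x / 2.
  by near: h; apply: dnbhs0_le; rewrite divr_gt0.
have h1 : `|h| <= 1 by near: h; exact: dnbhs0_le.
have hT : `|h| * T <= e.
  apply: (@le_trans _ _ (`|h| * (T + 1))); first by rewrite ler_wpM2l// lerDl.
  by rewrite -ler_pdivlMr//; near: h; apply: dnbhs0_le; rewrite divr_gt0.
apply: le_trans hT.
have nh0 : 0 < `|h| by rewrite normr_gt0.
have hE : h *: 1 + x - x = h by rewrite addrK [_ *: _]mulr1.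
have := lnGamma_quadratic (x := x) (y := h *: 1 + x) x0; rewrite hE => /(_ hx2 h1) q.
rewrite -(ler_pM2l nh0) -normrM [leRHS]mulrA -expr2; apply: le_trans q.
rewrite -[leRHS]normrN [X in X <= _](_ : _ =
  `|- (lnGamma (h *: 1 + x) - lnGamma x - h * digamma_lim x)|)//.
congr `|_|; rewrite /= mulrBr [_ *: (_ - _)]/(_ * _) mulrA divff// mul1r.
by move: (lnGamma _) (lnGamma x) (digamma_lim x) => a b c; ring.
Unshelve. all: by end_near. Qed.

Lemma digammaE x : 0 < x -> digamma x = digamma_lim x.
Proof.
move=> x0; have G0 := Gamma_gt0 x0.
have dG : is_derive x 1 (@Gamma R) (digamma_lim x * Gamma x).
  have dphi := is_derive_lnGamma x0.
  have dexp := is_derive1_comp (is_derive_expR (lnGamma x)) dphi.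
  rewrite mulrC -[X in X * _](lnK (_ : Gamma x \in Num.pos)) ?posrE//.
  apply: near_eq_is_derive dexp => //; near=> t.
  by rewrite /= /lnGamma lnK ?posrE ?Gamma_gt0//; near: t; exact: lt_nbhsr.
by rewrite /digamma derive1E derive_val mulfK// gt_eqF.
Unshelve. all: by end_near. Qed.

Lemma digamma_slope c e u v : 0 < c -> 0 <= e < 1 ->
  c * (1 - e) <= u -> u <= v -> v <= c * (1 + e) ->
  (v - u) * ((1 + e) ^- 2 * trigamma c) <= digamma v - digamma u
    <= (v - u) * ((1 - e) ^- 2 * trigamma c).
Proof.
move=> c0 e01 cu uv vc; have /andP[_ e1] := e01.
have u0 : 0 < u by apply: lt_le_trans cu; rewrite mulr_gt0// subr_gt0.
by rewrite !digammaE ?(lt_le_trans u0)//; exact: digamma_lim_slope.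
Qed.

(** The terms x/(x+k)^2 are not monotone in x, but by telescoping
      x sum_(k<=N) 1/(x+k)^2 =
        sum_(m<N) (m+1)/((x+m)(x+m+1)^2) + (N+1)/(x+N),
    where every term on the right decreases in x.  The term m = 0 provides a
    gap independent of N, which survives in the limit. *)
Lemma trigamma_mul_lt (a s : R) : 0 < a -> a < s -> s * trigamma s < a * trigamma a.
Proof.
move=> a0 as_; have s0 := lt_trans a0 as_.
pose S x N : R := \sum_(m < N) (m.+1%:R / ((x + m%:R) * (x + m.+1%:R) ^+ 2)).
have mulE x N : 0 < x ->
    x * trigamma_seq x N.+1 = S x N + N.+1%:R / (x + N%:R).
  move=> x0; elim: N => [|N IH].
    rewrite /S /trigamma_seq big_ord_recr !big_ord0/= !add0r addr0.
    by rewrite expr2 invfM mulrA divff ?mul1r ?div1r// gt_eqF.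
  rewrite trigamma_seqS mulrDr IH /S big_ord_recr/= -!addrA; congr (_ + _).
  have := addr_nat_gt0 N x0; rewrite -!natr1 => xN.
  by field; rewrite addrA !gt_eqF// addr_gt0.
have mono N : N.+1%:R / (s + N%:R) <= N.+1%:R / (a + N%:R).
  by rewrite ler_wpM2l// lef_pV2 ?posrE ?addr_nat_gt0// lerD2r ltW.
have term (m : nat) : (s + m%:R) * (s + m.+1%:R) ^+ 2 > (a + m%:R) * (a + m.+1%:R) ^+ 2.
  have h k : a + k%:R < s + k%:R by rewrite ltrD2r.
  by rewrite ltr_pM ?ltrXn2r ?ltW ?exprn_gt0 ?addr_nat_gt0.
pose d := 1 / (a * (a + 1) ^+ 2) - 1 / (s * (s + 1) ^+ 2).
have d0 : 0 < d.
  have := term 0%N; rewrite !addr0 subr_gt0 => h.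
  by rewrite ltr_pM2l// ltf_pV2 ?posrE ?mulr_gt0 ?exprn_gt0 ?addr_gt0.
have SS x N : S x N.+1 = S x N + N.+1%:R / ((x + N%:R) * (x + N.+1%:R) ^+ 2).
  by rewrite /S big_ord_recr.
have gapS N : d <= S a N.+1 - S s N.+1.
  elim: N => [|N IH]; first by rewrite !SS /S !big_ord0 !add0r !addr0.
  apply: (le_trans IH); rewrite !(SS _ N.+1) opprD addrACA lerDl subr_ge0.
  rewrite ler_wpM2l// lef_pV2 ?posrE ?mulr_gt0 ?exprn_gt0 ?addr_nat_gt0//.
  exact/ltW/term.
have cvgF x : 0 < x -> x * trigamma_seq x n.+2 @[n --> \oo] --> x * trigamma x.
  by move=> x0; apply: cvgMr; exact: (cvgS (cvgS (trigamma_seq_cvg x0))).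
suff : d <= a * trigamma a - s * trigamma s by move=> /(lt_le_trans d0); rewrite subr_gt0.
apply: (ler_cvg_to (cvg_cst _) (cvgB (cvgF _ a0) (cvgF _ s0))).
apply: nearW => N; rewrite [leRHS](_ : _ = a * trigamma_seq a N.+2 - s * trigamma_seq s N.+2)//.
rewrite !mulE// opprD addrACA.
by rewrite -[leLHS]addr0 lerD// subr_ge0 mono.
Qed.
End Trigamma.

(** * Local inversion of the digamma function *)

Section DigammaInverse.
Set Implicit Arguments.
Unset Strict Implicit.
Unset Printing Implicit Defensive.
Context {R : realType}.
Implicit Types c e u v y : R.

(** The slope estimate on the interval centred at v that reaches down to u. *)
Lemma digamma_incr u v : 0 < u -> u < v -> digamma u < digamma v.
Proof.
move=> u0 uv; have v0 := lt_trans u0 uv.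
have e01 : 0 <= 1 - u / v < 1.
  by rewrite subr_ge0 ler_pdivrMr// mul1r ltW//= gtrBl divr_gt0.
have lo : v * (1 - (1 - u / v)) <= u by rewrite subKr mulrCA divff ?mulr1// gt_eqF.
have hi : v <= v * (1 + (1 - u / v)).
  by rewrite ler_peMr ?(ltW v0)// lerDl; have /andP[] := e01.
have /andP[+ _] := digamma_slope v0 e01 lo (ltW uv) hi.
rewrite -(subr_gt0 (digamma u)); apply: lt_le_trans.
rewrite mulr_gt0 ?subr_gt0// mulr_gt0 ?trigamma_gt0// invr_gt0 exprn_gt0//.
by rewrite ltr_wpDr//; have /andP[] := e01.
Qed.

Lemma digammaK u : 0 < u -> digamma_inv (digamma u) = u.
Proof.
move=> u0; rewrite /digamma_inv pinvKV//; last by rewrite inE/= in_itv/= andbT.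
move=> x y; rewrite !inE/= !in_itv/= !andbT => x0 y0 xy.
have [h|h|//] := ltgtP x y.
  by have := digamma_incr x0 h; rewrite xy ltxx.
by have := digamma_incr y0 h; rewrite xy ltxx.
Qed.

(** The radius is relative to c, as in the weighted norm: the window of a sum of
    parameters contains the sum of their windows. *)
Definition window c e u := `|u - c| <= e * c.

Lemma windowP c e u : reflect (c * (1 - e) <= u <= c * (1 + e)) (window c e u).
Proof.
rewrite /window ler_distl.
have -> : c * (1 - e) = c - e * c by ring.
have -> : c * (1 + e) = c + e * c by ring.
exact: idP.
Qed.

Lemma window_gt0 c e u : 0 < c -> e < 1 -> window c e u -> 0 < u.
Proof.
move=> c0 e1 /windowP/andP[+ _]; apply: lt_le_trans.
by rewrite mulr_gt0// subr_gt0.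
Qed.

Lemma digamma_slope_norm c e u v : 0 < c -> 0 <= e < 1 ->
  window c e u -> window c e v ->
  `|v - u| * ((1 + e) ^- 2 * trigamma c) <= `|digamma v - digamma u|
    <= `|v - u| * ((1 - e) ^- 2 * trigamma c).
Proof.
move=> c0 e01; have /andP[_ e1] := e01.
wlog uv : u v / u <= v => [H wu wv|wu wv].
  have [uv|/ltW vu] := leP u v; first exact: H.
  by rewrite (distrC v) (distrC (digamma v)); exact: H.
have u0 := window_gt0 c0 e1 wu.
have le_psi : digamma u <= digamma v.
  by move: uv; rewrite le_eqVlt => /predU1P[->//|/(digamma_incr u0)/ltW].
rewrite !ger0_norm ?subr_ge0//.
move/windowP : wu => /andP[cu _]; move/windowP : wv => /andP[_ vc].
exact: digamma_slope.
Qed.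

Lemma window_dist_le c e u v y z B : 0 < c -> 0 <= e < 1 ->
  window c e u -> window c e v -> digamma u = y -> digamma v = z ->
  `|y - z| <= B * ((1 + e) ^- 2 * trigamma c) -> `|u - v| <= B.
Proof.
move=> c0 e01 wu wv <- <-; have /andP[e0 _] := e01.
have /andP[+ _] := digamma_slope_norm c0 e01 wv wu => /le_trans h /h.
rewrite ler_pM2r// mulr_gt0 ?trigamma_gt0// invr_gt0 exprn_gt0//.
by rewrite ltr_pwDl.
Qed.

Lemma digamma_continuous u : 0 < u -> {for u, continuous (@digamma R)}.
Proof.
move=> u0; set T := (1 - 2^-1) ^- 2 * trigamma u.
have T1 : 0 < T + 1.
  by rewrite ltr_pwDr// mulr_ge0 ?invr_ge0 ?sqr_ge0// ltW// trigamma_gt0.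
have e01 : 0 <= (2^-1 : R) < 1 by apply/andP; split; lra.
apply/cvgrPdist_le => /= e e0; near=> v.
have wv : window u 2^-1 v.
  rewrite /window distrC; near: v; apply: (@cvgr_dist_le _ _ _ _ _ _ u) => //.
  by rewrite mulr_gt0// invr_gt0.
have wu : window u 2^-1 u by rewrite /window subrr normr0 mulr_ge0 ?ltW.
have /andP[_ h] := digamma_slope_norm u0 e01 wv wu.
apply: (le_trans h); apply: (@le_trans _ _ (`|u - v| * (T + 1))).
  by rewrite ler_wpM2l// lerDl.
rewrite -ler_pdivlMr//; near: v; apply: (@cvgr_dist_le _ _ _ _ _ _ u) => //.
by rewrite divr_gt0.
Unshelve. all: by end_near. Qed.

(** By the slope bound, psi moves by at least the right-hand side from c to either
    end of the window, so y is a value taken inside it. *)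
Lemma digamma_inv_window c e y : 0 < c -> 0 <= e < 1 ->
  `|y - digamma c| <= e * c * ((1 + e) ^- 2 * trigamma c) ->
  window c e (digamma_inv y) /\ digamma (digamma_inv y) = y.
Proof.
move=> c0 e01 yc; have /andP[e0 e1] := e01.
have ec0 : 0 <= e * c by rewrite mulr_ge0// ltW.
have wc : window c e c by rewrite /window subrr normr0.
have wlo : window c e (c - e * c) by rewrite /window addrAC subrr add0r normrN ger0_norm.
have whi : window c e (c + e * c) by rewrite /window addrAC subrr add0r ger0_norm.
have lo0 := window_gt0 c0 e1 wlo.
have lohi : c - e * c <= c + e * c by rewrite lerD2l ge0_cp.
have [u] : exists2 u, u \in `[c - e * c, c + e * c] & digamma u = y.
  apply: IVT => //.
    apply: continuous_in_subspaceT => x; rewrite inE/= in_itv/= => /andP[xlo _].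
    by apply: digamma_continuous; exact: lt_le_trans xlo.
  have /windowP/andP[h1 h2] := wlo; have /windowP/andP[h3 h4] := whi.
  have cE : c * (1 - e) = c - e * c by ring.
  have cE' : c * (1 + e) = c + e * c by ring.
  have clo : c - e * c <= c by rewrite gerBl.
  have chi : c <= c + e * c by rewrite lerDl.
  have /andP[b1 _] : _ && _ := digamma_slope c0 e01 h1 clo (le_trans chi h4).
  have /andP[b2 _] : _ && _ := digamma_slope c0 e01 (le_trans h1 clo) chi h4.
  rewrite subKr in b1; rewrite addrAC subrr add0r in b2.
  have K0 : 0 <= (1 + e) ^- 2 * trigamma c.
    by rewrite mulr_ge0 ?invr_ge0 ?sqr_ge0// ltW// trigamma_gt0.
  have loc : digamma (c - e * c) <= digamma c by rewrite -subr_ge0 (le_trans _ b1)// mulr_ge0.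
  have chh : digamma c <= digamma (c + e * c) by rewrite -subr_ge0 (le_trans _ b2)// mulr_ge0.
  move: yc; rewrite ler_distl => /andP[y1 y2].
  rewrite ge_min le_max; apply/andP; split; apply/orP; [left|right].
    by rewrite (le_trans _ y1)// lerBrDl -lerBrDr.
  by apply: (le_trans y2); rewrite addrC -lerBrDr.
rewrite in_itv/= => /andP[ulo uhi] uy.
have wu : window c e u by rewrite /window ler_distl ulo.
by rewrite -uy digammaK// (window_gt0 c0 e1 wu).
Qed.

End DigammaInverse.

(** * One coordinate of the fixed-point map *)

Section CoordinateUpdate.
Set Implicit Arguments.
Unset Strict Implicit.
Unset Printing Implicit Defensive.
Context {R : realType} {I : finType}.
Variables (P : pred I) (k r c e q : R) (s : I -> R).
Implicit Types (t : I -> R) (d : R).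

(** In the application k is 1/(n-1), r is a row or column statistic, c is the
    coordinate of the solution that is updated, and s j is a sum a_i + b_j. *)
Definition mean_digamma t : R := k * r + k * \sum_(j | P j) digamma (t j).

Hypothesis k_mean : k * #|P|%:R = 1.
Hypothesis c_gt0 : 0 < c.
Hypothesis e01 : 0 <= e < 1.
Hypothesis q01 : 0 <= q <= 1.
Hypothesis s_gt0 : forall j, P j -> 0 < s j.
Hypothesis s_ratio : forall j, P j ->
  (1 + e) ^+ 2 * (s j * trigamma (s j)) <= q * (1 - e) ^+ 2 * (c * trigamma c).
Hypothesis fixed_c : mean_digamma s = digamma c.

Definition window_family t := forall j, P j -> window (s j) e (t j).

(** Each psi(t j) varies by at most d (s j) D(s j)/(1-e)^2, and the ratio
    hypothesis turns this into q d c D(c)/(1+e)^2, a quantity comparable with the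
    least slope of psi on the window of c. *)
Lemma mean_digamma_lipschitz t t' d : window_family t -> window_family t' ->
  (forall j, P j -> `|t j - t' j| <= d * s j) ->
  `|mean_digamma t - mean_digamma t'| <= q * d * c * ((1 + e) ^- 2 * trigamma c).
Proof.
move=> wt wt' td; have /andP[e0 e1] := e01.
set B := (X in _ <= X).
have k0 : 0 <= k.
  rewrite leNgt; apply/negP => kneg.
  have : k * #|P|%:R <= 0 by rewrite mulr_le0_ge0// ltW.
  by rewrite k_mean leNgt ltr01.
have B_bound j : P j -> `|digamma (t j) - digamma (t' j)| <= B.
  move=> Pj; have sj := s_gt0 Pj.
  have /andP[_ h] := digamma_slope_norm sj e01 (wt' j Pj) (wt j Pj).
  have T0 : 0 <= (1 - e) ^- 2 * trigamma (s j).
    by rewrite mulr_ge0 ?invr_ge0 ?sqr_ge0// ltW// trigamma_gt0.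
  apply: (le_trans h); apply: (le_trans (ler_wpM2r T0 (td j Pj))).
  have d0 : 0 <= d.
    by rewrite -(pmulr_lge0 _ sj) (le_trans _ (td j Pj)).
  have p1 : 0 < (1 + e) ^+ 2 by rewrite exprn_gt0// ltr_pwDl.
  have p2 : 0 < (1 - e) ^+ 2 by rewrite exprn_gt0// subr_gt0.
  have -> : d * s j * ((1 - e) ^- 2 * trigamma (s j)) =
      d * (s j * trigamma (s j)) / (1 - e) ^+ 2.
    by move: (s j) (_ ^+ 2) (trigamma _) => x y z; ring.
  have -> : B = d * (q * (c * trigamma c)) / (1 + e) ^+ 2.
    by rewrite /B; move: (_ ^+ 2) (trigamma _) => x y; ring.
  rewrite -[leLHS]mulrA -[leRHS]mulrA ler_wpM2l// ler_pdivrMr//.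
  by rewrite [leRHS]mulrAC ler_pdivlMr// mulrC [leRHS]mulrAC s_ratio.
rewrite /mean_digamma opprD addrACA subrr add0r -mulrBr -sumrB normrM ger0_norm//.
apply: (@le_trans _ _ (k * \sum_(j | P j) B)).
  rewrite ler_wpM2l//; apply: (le_trans (ler_norm_sum _ _ _)).
  by apply: ler_sum => j Pj; exact: B_bound.
by rewrite sumr_const -mulr_natl mulrA k_mean mul1r.
Qed.

Lemma digamma_inv_mean_window t : window_family t ->
  window c e (digamma_inv (mean_digamma t)) /\
  digamma (digamma_inv (mean_digamma t)) = mean_digamma t.
Proof.
move=> wt; have /andP[e0 e1] := e01; have /andP[q0 q1] := q01.
apply: digamma_inv_window => //; rewrite -fixed_c.
have ws : window_family s.
  by move=> j Pj; rewrite /window subrr normr0 mulr_ge0// ltW// s_gt0.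
apply: (le_trans (mean_digamma_lipschitz wt ws wt)).
rewrite ler_wpM2r//.
  by rewrite mulr_ge0 ?invr_ge0 ?sqr_ge0// ltW// trigamma_gt0.
by rewrite -mulrA ler_piMl// mulr_ge0// ltW.
Qed.

Lemma digamma_inv_mean_lipschitz t t' d : window_family t -> window_family t' ->
  (forall j, P j -> `|t j - t' j| <= d * s j) ->
  `|digamma_inv (mean_digamma t) - digamma_inv (mean_digamma t')| <= q * d * c.
Proof.
move=> wt wt' td.
have [w1 E1] := digamma_inv_mean_window wt.
have [w2 E2] := digamma_inv_mean_window wt'.
exact: (window_dist_le c_gt0 e01 w1 w2 E1 E2 (mean_digamma_lipschitz wt wt' td)).
Qed.

End CoordinateUpdate.

(** * Weighted maximum norms *)

Section WeightedNorm.
Set Implicit Arguments.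
Unset Strict Implicit.
Unset Printing Implicit Defensive.
Context {R : realType} {m : nat}.
Variable w : 'rV[R]_m.
Hypothesis w_gt0 : forall k, 0 < w 0 k.
Implicit Types x y : 'rV[R]_m.

Definition weighted_norm x : R := `|\row_k (x 0 k / w 0 k)|.

Lemma weighted_norm_leP x r : 0 <= r ->
  weighted_norm x <= r <-> (forall k, `|x 0 k| <= r * w 0 k).
Proof.
move=> r0; have coordE k : `|(\row_k (x 0 k / w 0 k)) 0 k| = `|x 0 k| / w 0 k.
  by rewrite mxE normrM normfV (gtr0_norm (w_gt0 k)).
rewrite /weighted_norm [`|_|]mx_normrE; split => [/bigmax_leP[_ h] k|h].
  by have := h (0, k) isT; rewrite /= coordE ler_pdivrMr.
apply/bigmax_leP; split => // -[i k] _ /=.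
by rewrite ord1 coordE ler_pdivrMr.
Qed.

Lemma weighted_norm_ge0 x : 0 <= weighted_norm x.
Proof. exact: normr_ge0. Qed.

Lemma weighted_norm_coord x k : `|x 0 k| <= weighted_norm x * w 0 k.
Proof. by move: k; apply/(weighted_norm_leP x (weighted_norm_ge0 x)). Qed.

Lemma weighted_norm_is_norm : is_norm weighted_norm.
Proof.
split=> [x x0|c x|x y].
- apply/rowP => k; rewrite mxE; have := weighted_norm_coord x k.
  by rewrite x0 mul0r normr_le0 => /eqP.
- rewrite /weighted_norm -normrZ; congr `|_|.
  by apply/rowP => k; rewrite !mxE mulrA.
- rewrite /weighted_norm; apply: le_trans (ler_normD _ _).
  rewrite (_ : \row_k ((x + y) 0 k / w 0 k) = \row_k (x 0 k / w 0 k) + \row_k (y 0 k / w 0 k))//.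
  by apply/rowP => k; rewrite !mxE mulrDl.
Qed.

Definition weighted_box (e : R) : set 'rV[R]_m :=
  [set x | forall k, window (w 0 k) e (x 0 k)].

Lemma weighted_box_closed e : closed (weighted_box e).
Proof.
rewrite (_ : weighted_box e =
    \bigcap_(k in setT) [set x : 'rV[R]_m | `|x 0 k - w 0 k| <= e * w 0 k]); last first.
  by apply/seteqP; split => x /= h k; [move=> _; exact: h|exact: h].
apply: closed_bigI => k _.
have dist_cont : continuous (fun x : 'rV[R]_m => `|x 0 k - w 0 k|).
  by move=> x; exact: (cvg_norm (cvgB (@coord_continuous R 1 m 0 k x) (cvg_cst (w 0 k)))).
exact: ((continuous_closedP _).1 dist_cont _ (@closed_le R (e * w 0 k))).
Qed.

Lemma weighted_box_nbhs (e : R) : 0 < e -> nbhs w (weighted_box e).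
Proof.
move=> e0; have near_w k : \forall x \near w, window (w 0 k) e ((x : 'rV[R]_m) 0 k).
  have /cvgr_dist_le/(_ (e * w 0 k)) := @coord_continuous R 1 m 0 k w.
  by rewrite mulr_gt0// => /(_ isT); apply: filterS => x; rewrite /window distrC.
exact: (@filter_forall _ _ (fun k (x : 'rV[R]_m) => window (w 0 k) e (x 0 k)) _ _ near_w).
Qed.

(** The geometric bound holds in the weighted norm; multiplying it by the norm of w
    gives one in the ambient norm. *)
Lemma weighted_norm_contraction_cvg (f : 'rV[R]_m -> 'rV[R]_m) (K : set 'rV[R]_m) (q : R)
    (theta : nat -> 'rV[R]_m) :
  0 <= q < 1 -> K w -> f w = w -> f @` K `<=` K ->
  (forall x y, K x -> K y -> weighted_norm (f x - f y) <= q * weighted_norm (x - y)) ->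
  K (theta 0%N) -> (forall it, theta it.+1 = f (theta it)) ->
  theta @ \oo --> w.
Proof.
move=> /andP[q0 q1] Kw fw fK fq K0 step.
have Kt it : K (theta it).
  by elim: it => // it IH; rewrite step; apply: fK; exists (theta it).
set C := weighted_norm (theta 0%N - w).
have geo it : weighted_norm (theta it - w) <= q ^+ it * C.
  elim: it => [|it IH]; first by rewrite expr0 mul1r.
  rewrite step -[in X in weighted_norm (_ - X)]fw (le_trans (fq _ _ (Kt it) Kw))//.
  by rewrite exprS -mulrA ler_wpM2l.
have bound it : `|w - theta it| <= q ^+ it * (C * `|w|).
  rewrite distrC [`|_ - _|]mx_normrE; apply/bigmax_leP; split.
    by rewrite !mulr_ge0 ?exprn_ge0 ?weighted_norm_ge0.
  move=> [i k] _ /=; rewrite ord1 (le_trans (weighted_norm_coord _ k))//.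
  rewrite mulrA ler_pM ?weighted_norm_ge0 ?geo ?(ltW (w_gt0 k))//.
  rewrite -[leLHS](gtr0_norm (w_gt0 k)) [leRHS]mx_normrE.
  by rewrite (le_bigmax _ (fun ij : 'I_1 * 'I_m => `|w ij.1 ij.2|) (0, k)).
have geo0 : q ^+ it * (C * `|w|) @[it --> \oo] --> (0 : R).
  rewrite -(mul0r (C * `|w|)); apply: cvgMl.
  by apply: cvg_expr; rewrite ger0_norm.
apply/cvgrPdist_le => e e0; near=> it; apply: (le_trans (bound it)).
near: it; move/cvgrPdist_le : geo0 => /(_ e e0); apply: filterS => it.
by rewrite sub0r normrN; apply: le_trans; exact: ler_norm.
Unshelve. all: by end_near. Qed.

End WeightedNorm.

(** * The fixed-point map near a solution *)

Section FixedPointMap.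
Set Implicit Arguments.
Unset Strict Implicit.
Unset Printing Implicit Defensive.
Context {R : realType}.

(** Let rho < 1 be the largest ratio A/B.  The room 1 - rho is split between
    q = (1 + rho)/2 and the factor ((1+e)/(1-e))^2. *)
Lemma uniform_ratio (T : finType) (P : pred T) (A B : T -> R) :
  (forall k, P k -> 0 <= A k < B k) ->
  exists e q : R, [/\ 0 < e < 1, 0 <= q < 1 &
    forall k, P k -> (1 + e) ^+ 2 * A k <= q * (1 - e) ^+ 2 * B k].
Proof.
move=> AB; pose rho := \big[Num.max/0]_(k | P k) (A k / B k).
have B0 k : P k -> 0 < B k by move=> /AB/andP[]; exact: le_lt_trans.
have rho0 : 0 <= rho by apply/bigmax_geP; left.
have rho1 : rho < 1.
  apply/bigmax_ltP; split => // k Pk.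
  by rewrite ltr_pdivrMr ?B0// mul1r; have /andP[] := AB k Pk.
have rhoP k : P k -> A k <= rho * B k.
  by move=> Pk; rewrite -ler_pdivrMr ?B0// (le_bigmax_cond _ (fun k => A k / B k)).
clearbody rho.
exists ((1 - rho) / 16), ((1 + rho) / 2); split; [apply/andP; split; lra..|].
move=> k Pk; set e := (1 - rho) / 16.
apply: (@le_trans _ _ ((1 + e) ^+ 2 * (rho * B k))).
  by rewrite ler_wpM2l ?sqr_ge0// rhoP.
rewrite mulrA ler_wpM2r ?(ltW (B0 k Pk))//.
have -> : rho = 1 - 16 * e by rewrite /e; field.
have e0 : 0 <= e by rewrite /e; lra.
have e1 : e <= 1 / 16 by rewrite /e; lra.
clearbody e; clear - e0 e1; nra.
Qed.

Lemma rowB_coord m (x y : 'rV[R]_m) k : (x - y) 0 k = x 0 k - y 0 k.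
Proof. by rewrite !mxE. Qed.

(* The entries are kept abstract here: unification would otherwise compare two
   values of the fixed-point map by unfolding them down to Euler's integral. *)
Lemma row_mx_coord n (Q : 'I_(n + n) -> R -> R -> Prop) (u u' v v' : 'I_n -> R) :
  (forall i, Q (lshift n i) (u i) (u' i)) ->
  (forall j, Q (rshift n j) (v j) (v' j)) ->
  forall k, Q k (row_mx (\row_i u i) (\row_j v j) 0 k)
                (row_mx (\row_i u' i) (\row_j v' j) 0 k).
Proof.
move=> Qu Qv k; case: (split_ordP k) => l ->.
  by rewrite !row_mxEl !mxE; exact: Qu.
by rewrite !row_mxEr !mxE; exact: Qv.
Qed.

Variables (n : nat) (W : 'M[R]_n) (th : 'rV[R]_(n + n)).
Hypothesis n_ge2 : (2 <= n)%N.
Hypothesis th_sol : ML_solution W th.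

Let th_gt0 k : 0 < th 0 k. Proof. by case: th_sol => + _; apply. Qed.

Lemma par_aE (x : 'rV[R]_(n + n)) i : par_a x i = x 0 (lshift n i).
Proof. by rewrite /par_a mxE. Qed.

Lemma par_bE (x : 'rV[R]_(n + n)) j : par_b x j = x 0 (rshift n j).
Proof. by rewrite /par_b mxE. Qed.

Lemma fpmap_gE x i : fpmap_g W x i = digamma_inv (mean_digamma (predC1 i)
  (n%:R - 1)^-1 (rowstat W i) (fun j => par_a x i + par_b x j)).
Proof. by []. Qed.

Lemma fpmap_hE x j : fpmap_h W x j = digamma_inv (mean_digamma (predC1 j)
  (n%:R - 1)^-1 (colstat W j) (fun i => par_a x i + par_b x j)).
Proof. by []. Qed.

Let n1_gt0 : 0 < n%:R - 1 :> R.
Proof. by rewrite subr_gt0 ltr1n. Qed.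

Lemma mean_weight (i : 'I_n) : (n%:R - 1)^-1 * #|predC1 i|%:R = 1 :> R.
Proof.
rewrite cardC1 card_ord -subn1 natrB ?(ltnW n_ge2)//.
by rewrite mulVf// gt_eqF.
Qed.

Lemma mean_digamma_row i : mean_digamma (predC1 i) (n%:R - 1)^-1 (rowstat W i)
  (fun j => par_a th i + par_b th j) = digamma (par_a th i).
Proof.
case: th_sol => _ [/(_ i) + _]; rewrite /mean_digamma -mulrDr.
move: (\sum_(j | _) _) (digamma _) (rowstat W i) => S D r eq0.
have -> : r + S = (n%:R - 1) * D.
  by apply/eqP; rewrite -subr_eq0 -eq0; apply/eqP; ring.
by rewrite mulKf// gt_eqF.
Qed.

Lemma mean_digamma_col j : mean_digamma (predC1 j) (n%:R - 1)^-1 (colstat W j)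
  (fun i => par_a th i + par_b th j) = digamma (par_b th j).
Proof.
case: th_sol => _ [_ /(_ j)]; rewrite /mean_digamma -mulrDr.
move: (\sum_(i | _) _) (digamma (par_b th j)) (colstat W j) => S D r eq0.
have -> : r + S = (n%:R - 1) * D.
  by apply/eqP; rewrite -subr_eq0 -eq0; apply/eqP; ring.
by rewrite mulKf// gt_eqF.
Qed.

Lemma fpmap_coord (Q : 'I_(n + n) -> R -> R -> Prop) x y :
  (forall i, Q (lshift n i) (fpmap_g W x i) (fpmap_g W y i)) ->
  (forall j, Q (rshift n j) (fpmap_h W x j) (fpmap_h W y j)) ->
  forall k, Q k (fpmap W x 0 k) (fpmap W y 0 k).
Proof. exact: row_mx_coord. Qed.

Lemma par_gt0 i j : [/\ 0 < par_a th i, 0 < par_b th j & 0 < par_a th i + par_b th j].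
Proof. by rewrite par_aE par_bE addr_gt0. Qed.

Lemma fpmap_fixed : fpmap W th = th.
Proof.
apply/rowP; apply: (@fpmap_coord (fun k u _ => u = th 0 k) th th) => l.
  rewrite fpmap_gE mean_digamma_row -par_aE digammaK//.
  by case: (par_gt0 l l).
rewrite fpmap_hE mean_digamma_col -par_bE digammaK//.
by case: (par_gt0 l l).
Qed.

(** The minimum makes one ratio serve both the update of a_i and that of b_j. *)
Lemma trigamma_ratio (i j : 'I_n) :
  let s := par_a th i + par_b th j in
  0 <= s * trigamma s < Num.min (par_a th i * trigamma (par_a th i))
                                (par_b th j * trigamma (par_b th j)).
Proof.
have [a0 b0 s0] := par_gt0 i j.
rewrite /= mulr_ge0 ?ltW ?trigamma_gt0//= lt_min !trigamma_mul_lt//.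
  by rewrite ltrDr.
by rewrite ltrDl.
Qed.

Lemma window_par_sum e x i j : weighted_box th e x ->
  window (par_a th i + par_b th j) e (par_a x i + par_b x j).
Proof.
move=> Kx; rewrite !par_aE !par_bE /window opprD addrACA mulrDr.
exact: le_trans (ler_normD _ _) (lerD (Kx _) (Kx _)).
Qed.

Lemma par_sum_dist x y i j :
  `|par_a x i + par_b x j - (par_a y i + par_b y j)| <=
  weighted_norm th (x - y) * (par_a th i + par_b th j).
Proof.
rewrite !par_aE !par_bE opprD addrACA mulrDr.
rewrite -!rowB_coord; apply: le_trans (ler_normD _ _) (lerD _ _); exact: weighted_norm_coord.
Qed.

Lemma fpmap_contraction : exists e q : R, [/\ 0 < e < 1, 0 <= q < 1,
  fpmap W @` weighted_box th e `<=` weighted_box th e &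
  forall x y, weighted_box th e x -> weighted_box th e y ->
    weighted_norm th (fpmap W x - fpmap W y) <= q * weighted_norm th (x - y)].
Proof.
have [e [q [e01 q01 ratio]]] := @uniform_ratio ('I_n * 'I_n)%type predT _ _
  (fun ij _ => trigamma_ratio ij.1 ij.2).
have e01' : 0 <= e < 1 by have /andP[/ltW -> ->] := e01.
have q01' : 0 <= q <= 1 by have /andP[-> /ltW ->] := q01.
have /andP[q0 _] := q01; have /andP[_ e1] := e01.
have p2 : 0 <= q * (1 - e) ^+ 2 by rewrite mulr_ge0// sqr_ge0.
have ratio_a i j : predC1 i j -> (1 + e) ^+ 2 * ((par_a th i + par_b th j) *
    trigamma (par_a th i + par_b th j)) <=
    q * (1 - e) ^+ 2 * (par_a th i * trigamma (par_a th i)).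
  move=> _; apply: (le_trans (ratio (i, j) isT)); rewrite ler_wpM2l//.
  by rewrite ge_min lexx.
have ratio_b j i : predC1 j i -> (1 + e) ^+ 2 * ((par_a th i + par_b th j) *
    trigamma (par_a th i + par_b th j)) <=
    q * (1 - e) ^+ 2 * (par_b th j * trigamma (par_b th j)).
  move=> _; apply: (le_trans (ratio (i, j) isT)); rewrite ler_wpM2l//.
  by rewrite ge_min lexx orbT.
have sum_gt0 i j : 0 < par_a th i + par_b th j by case: (par_gt0 i j).
have row_window x i : weighted_box th e x -> window_family (predC1 i) e
    (fun j => par_a th i + par_b th j) (fun j => par_a x i + par_b x j).
  by move=> Kx j _; exact: window_par_sum.
have col_window x j : weighted_box th e x -> window_family (predC1 j) e
    (fun i => par_a th i + par_b th j) (fun i => par_a x i + par_b x j).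
  by move=> Kx i _; exact: window_par_sum.
exists e, q; split=> //.
- move=> _ [x Kx <-].
  apply: (@fpmap_coord (fun k u _ => window (th 0 k) e u) x x) => l.
    rewrite -par_aE; have [a0 _ _] := par_gt0 l l.
    exact: (digamma_inv_mean_window (mean_weight l) a0 e01' q01'
      (fun j _ => sum_gt0 l j) (ratio_a l) (mean_digamma_row l) (row_window x l Kx)).1.
  rewrite -par_bE; have [_ b0 _] := par_gt0 l l.
  exact: (digamma_inv_mean_window (mean_weight l) b0 e01' q01'
    (fun i _ => sum_gt0 i l) (ratio_b l) (mean_digamma_col l) (col_window x l Kx)).1.
- move=> x y Kx Ky; set N := weighted_norm th (x - y).
  apply/(weighted_norm_leP th_gt0 _ (mulr_ge0 q0 (weighted_norm_ge0 _ _))) => k.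
  rewrite rowB_coord.
  move: k; apply: (@fpmap_coord (fun k u v => `|u - v| <= q * N * th 0 k) x y) => l.
    rewrite -par_aE; have [a0 _ _] := par_gt0 l l.
    exact: (digamma_inv_mean_lipschitz (mean_weight l) a0 e01' q01'
      (fun j _ => sum_gt0 l j) (ratio_a l) (mean_digamma_row l)
      (row_window x l Kx) (row_window y l Ky) (fun j _ => par_sum_dist x y l j)).
  rewrite -par_bE; have [_ b0 _] := par_gt0 l l.
  exact: (digamma_inv_mean_lipschitz (mean_weight l) b0 e01' q01'
    (fun i _ => sum_gt0 i l) (ratio_b l) (mean_digamma_col l)
    (col_window x l Kx) (col_window y l Ky) (fun i _ => par_sum_dist x y i l)).
Qed.

End FixedPointMap.

Theorem theorem2 (R : realType) (n : nat) (W : 'M[R]_n)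
    (thetahat : 'rV[R]_(n + n)) :
  (2 <= n)%N ->
  (forall i : 'I_n, W i i = 0) ->
  (forall i j : 'I_n, i != j -> 0 < W i j < 1) ->
  unique (ML_solution W) thetahat ->
  exists K : set 'rV[R]_(n + n),
    [/\ closed K,
        nbhs thetahat K,
        is_contraction_on (fpmap W) K,
        fpmap W thetahat = thetahat
      & forall theta : nat -> 'rV[R]_(n + n),
          K (theta 0%N) ->
          (forall it : nat, theta it.+1 = fpmap W (theta it)) ->
          theta @ \oo --> thetahat].
Proof.
move=> n2 _ _ [sol _].
have th0 k : 0 < thetahat 0 k by case: sol => + _; apply.
have [e [q [e01 q01 fK fq]]] := fpmap_contraction n2 sol.
have /andP[e0 e1] := e01; have /andP[q0 q1] := q01.
have Kth : weighted_box thetahat e thetahat.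
  by move=> k; rewrite /window subrr normr0 mulr_ge0 ?ltW.
have fixed := fpmap_fixed n2 sol.
exists (weighted_box thetahat e); split => //.
- exact: weighted_box_closed.
- exact: weighted_box_nbhs.
- split => //; first by move=> x Kx k; exact: window_gt0 (th0 k) e1 (Kx k).
  exists (weighted_norm thetahat), q; split => //.
  exact: weighted_norm_is_norm.
- move=> theta K0 step.
  exact: (weighted_norm_contraction_cvg th0 q01 Kth fixed fK fq K0 step).
Qed.
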